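(* Let $F$ satisfy Condition (I) or Condition (II) (both stated in the context) and let $T>3$. Then the hindsight regret of the certainty equivalent policy satisfies $$\mathrm{Reg}_{\mathbf b,T}(\pi^{\mathsf{CE}})\le\mathcal C_0\log T+\sum_{t=1}^T\mathbb E\Big[(\mathbf a_t^\top\bar{\boldsymbol\lambda}^\star_t-r_t)\mathbf 1\{\mathbf a_t^\top\tilde{\boldsymbol\lambda}_t\le r_t\le\mathbf a_t^\top\bar{\boldsymbol\lambda}^\star_t\}\Big]+\sum_{t=1}^T\mathbb E\Big[(r_t-\mathbf a_t^\top\boldsymbol\lambda^\star_t)\mathbf 1\{\mathbf a_t^\top\boldsymbol\lambda^\star_t\le r_t\le\mathbf a_t^\top\tilde{\boldsymbol\lambda}_t\}\Big],$$ where $\mathcal C_0=2\big(1+\frac{m\bar A}{\underline A}\big)m\bar r$ and the expectation is over $\{(\mathbf a_j,r_j)\}_{j=1}^T$.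
   Context: Model. There are $m$ resources with initial inventory $\mathbf b\in\mathbb R^m_{\ge0}$ and $T$ periods. Requests $(\mathbf a_t,r_t)$, $t=1,\dots,T$, are i.i.d. with known joint distribution $F$. A policy $\pi$ chooses $x_t^\pi\in\{0,1\}$ in period $t$ after seeing $(\mathbf a_t,r_t)$; accepting ($x_t^\pi=1$) consumes $\mathbf a_t$, earns $r_t$, and is feasible only if $\mathbf a_t$ is componentwise at most the remaining inventory. $V^{\mathrm{hind}}_{\mathbf b,T}$ is the expectation of the optimal value of: maximize $\sum_{t=1}^T r_tx_t$ subject to $\sum_{t=1}^T \mathbf a_tx_t\le\mathbf b$, $x_t\in[0,1]$. $\mathrm{Reg}_{\mathbf b,T}(\pi)=V^{\mathrm{hind}}_{\mathbf b,T}-\mathbb E[\sum_{t=1}^T r_tx_t^\pi]$. Certainty equivalent (CE) policy $\pi^{\mathsf{CE}}$. Let $\mathbf b_0=\mathbf b$. In period $t$ let $\tilde{\boldsymbol\lambda}_t\in\arg\min_{\boldsymbol\lambda\in\mathbb R^m_{\ge0}}\big\{\frac{1}{T-t}\mathbf b_{t-1}^\top\boldsymbol\lambda+\mathbb E_{(\mathbf a,r)\sim F}[(r-\mathbf a^\top\boldsymbol\lambda)^+]\big\}$, where for $t=T$ one takes $\tilde{\boldsymbol\lambda}_T\in\arg\min_{\boldsymbol\lambda\in\mathbb R^m_{\ge0}}\mathbf b_{T-1}^\top\boldsymbol\lambda$. Set $x_t^{\mathsf{CE}}=1$ if and only if $r_t\ge\mathbf a_t^\top\tilde{\boldsymbol\lambda}_t$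 and $\mathbf a_t\le\mathbf b_{t-1}$ componentwise, and $\mathbf b_t=\mathbf b_{t-1}-x_t^{\mathsf{CE}}\mathbf a_t$ (so $\mathbf b_{t-1}$ is the remaining inventory under CE). Hindsight dual solutions: $\boldsymbol\lambda^\star_t\in\arg\min_{\boldsymbol\lambda\in\mathbb R^m_{\ge0}}\mathbf b_{t-1}^\top\boldsymbol\lambda+\sum_{j=t+1}^T(r_j-\mathbf a_j^\top\boldsymbol\lambda)^+$, and, when $\mathbf b_{t-1}\ge\mathbf a_t$ componentwise, $\bar{\boldsymbol\lambda}^\star_t\in\arg\min_{\boldsymbol\lambda\in\mathbb R^m_{\ge0}}(\mathbf b_{t-1}-\mathbf a_t)^\top\boldsymbol\lambda+\sum_{j=t+1}^T(r_j-\mathbf a_j^\top\boldsymbol\lambda)^+$. When $\mathbf b_{t-1}\ge\mathbf a_t$ fails, $\bar{\boldsymbol\lambda}^\star_t$ is not defined and the corresponding summand is read as $0$. All minimizers are taken in $\Omega=[0,\bar r/\underline A]^m$ (minimizers in $\Omega$ exist). Notation. $F^{\mathbf a}$ is the marginal distribution of $\mathbf a$; $F^r_{\mathbf a}$ is the conditional CDF of $r$ given $\mathbf a$; $\mathrm{supp}$ denotes support; $\mathcal B(\mathbf a,\rho)$ is the Euclidean ball. Condition (I). (i) There are constants $0<\underline A\le\bar A$ and $\bar r>0$ with $\mathrm{supp}(F)\subseteq[\underline A,\bar A]^m\times[0,\bar r]$. (ii) For every $\mathbf a\in\mathrm{supp}(F^{\mathbf a})$, $\mathrm{supp}(F^r_{\mathbf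 a})=[0,r_{\mathbf a}]$ for some $r_{\mathbf a}>0$. (iii) There are constants $\beta\ge0$ and $\nu,c_\nu,c_\beta>0$ such that for every $\mathbf a\in\mathrm{supp}(F^{\mathbf a})$ and all $0\le z_1<z_2\le r_{\mathbf a}$: $c_\beta(z_2-z_1)^{1+\beta}\le F^r_{\mathbf a}(z_2)-F^r_{\mathbf a}(z_1)\le c_\nu(z_2-z_1)^\nu$. Condition (II). (i) As (i) of Condition (I). (ii) $\mathrm{supp}(F^{\mathbf a})$ is convex and compact, $F^{\mathbf a}$ has a probability density bounded below on its support by a constant $l_f>0$, and $\mathrm{supp}(F^r_{\mathbf a})=[l(\mathbf a),r(\mathbf a)]$ where $l,r$ are Lipschitz in $\mathbf a$ with constant $c_L$. (iii) There are $\mathbf a_o\in\mathrm{supp}(F^{\mathbf a})$ and $r_0>0$ with $l(\mathbf a)=0$ for all $\mathbf a\in\mathcal B(\mathbf a_o,r_0)\cap\mathrm{supp}(F^{\mathbf a})$. (iv) There are constants $\beta\ge0$ and $\nu,c_\nu,c_\beta>0$ such that for every $\mathbf a\in\mathrm{supp}(F^{\mathbf a})$ and all $l(\mathbf a)\le z_1<z_2\le r(\mathbf a)$: $c_\beta(z_2-z_1)^{1+\beta}\le F^r_{\mathbf a}(z_2)-F^r_{\mathbf a}(z_1)\le c_\nu(z_2-z_1)^\nu$. *)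

(* Defs.v *)
From HB Require Import structures.
From mathcomp Require Import all_boot all_order all_algebra.
From mathcomp Require Import all_classical all_reals all_analysis.

Set Implicit Arguments.
Unset Strict Implicit.
Unset Printing Implicit Defensive.

Import Order.TTheory GRing.Theory Num.Theory.
Import numFieldNormedType.Exports.

Local Open Scope classical_set_scope.
Local Open Scope ring_scope.

(* 'rV[T]_n carries the product sigma-algebra (the one generated by the
   coordinates), i.e. the Borel sigma-algebra when T is the real line. *)
Definition measure_rV_display : measure_display -> measure_display.
Proof. exact. Qed.

Section measurable_rV.
Context {d} {T : sigmaRingType d}.
Variable n : nat.

Let coors : 'I_n -> 'rV[T]_n -> T := fun i v => v ord0 i.

Let rV_set0 : g_sigma_preimage coors set0.
Proof. exact: sigma_algebra0. Qed.

Let rV_setC A : g_sigma_preimage coors A -> g_sigma_preimage coors (~` A).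
Proof. exact: sigma_algebraC. Qed.

Let rV_bigcup (F : _^nat) : (forall i, g_sigma_preimage coors (F i)) ->
  g_sigma_preimage coors (\bigcup_i (F i)).
Proof. exact: sigma_algebra_bigcup. Qed.

HB.instance Definition _ := @isMeasurable.Build (measure_rV_display d)
  'rV[T]_n (g_sigma_preimage coors) rV_set0 rV_setC rV_bigcup.

End measurable_rV.

Lemma measurable_coord d (T : sigmaRingType d) n (i : 'I_n) :
  measurable_fun [set: 'rV[T]_n] (fun v : 'rV[T]_n => v ord0 i).
Proof.
move=> _ Y mY; rewrite setTI; apply: sub_sigma_algebra => /=.
rewrite -bigcup_seq/=; exists i => /=; first by rewrite mem_index_enum.
by exists Y => //; rewrite setTI.
Qed.

Lemma measurable_fun_rVP d1 d2 (T1 : measurableType d1) (T2 : measurableType d2)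
    n (f : T1 -> 'rV[T2]_n) :
  measurable_fun [set: T1] f <->
  forall i, measurable_fun [set: T1] (fun x => f x ord0 i).
Proof.
split=> [mf i|mf].
  exact: (@measurableT_comp _ _ _ _ _ _ (fun v : 'rV[T2]_n => v ord0 i) _ f
    (measurable_coord (T := T2) i) mf).
suff : forall A : set 'rV[T2]_n, measurable A -> measurable (f @^-1` A).
  by move=> h _ A mA; rewrite setTI; exact: h.
move=> A mA.
pose G := [set B : set 'rV[T2]_n | measurable (f @^-1` B)].
suff : measurable `<=` G by exact.
apply: smallest_sub.
  split.
  - by rewrite /G/= preimage_set0.
  - by move=> B; rewrite /G/= setTD preimage_setC => ?; exact: measurableC.
  - by move=> B mB; rewrite /G/= preimage_bigcup; exact: bigcupT_measurable.
rewrite -bigcup_seq => _ [i _ [Y mY <-]]; rewrite /G/= setTI.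
by have := mf i measurableT Y mY; rewrite setTI.
Qed.

Section lebesgue_rV.
Context {R : realType}.

Definition cons_rV n (p : measurableTypeR R * 'rV[R]_n) : 'rV[R]_n.+1 :=
  \row_i (if unlift ord0 i is Some j then p.2 ord0 j else p.1).

Definition uncons_rV n (v : 'rV[R]_n.+1) : measurableTypeR R * 'rV[R]_n :=
  (v ord0 ord0, \row_j v ord0 (lift ord0 j)).

Lemma measurable_cons_rV n : measurable_fun setT (@cons_rV n).
Proof.
apply/measurable_fun_rVP => i.
case: (unliftP ord0 i) => [j ->|->].
  rewrite (_ : (fun _ => _) = (fun v : 'rV[R]_n => v ord0 j) \o snd).
    by apply: measurableT_comp => //; exact: measurable_coord.
  by apply/funext => p; rewrite /cons_rV mxE liftK.
rewrite (_ : (fun _ => _) = fst)//.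
by apply/funext => p; rewrite /cons_rV mxE unlift_none.
Qed.

Lemma measurable_uncons_rV n : measurable_fun setT (@uncons_rV n).
Proof.
apply/measurable_fun_pair => /=; first exact: measurable_coord.
apply/measurable_fun_rVP => i.
rewrite (_ : (fun _ => _) = fun v : 'rV[R]_n.+1 => v ord0 (lift ord0 i)).
  exact: measurable_coord.
by apply/funext => v; rewrite mxE.
Qed.

Lemma cons_rVK n : cancel (@cons_rV n) (@uncons_rV n).
Proof.
move=> [x v]; congr pair; first by rewrite /cons_rV mxE unlift_none.
by apply/rowP => j; rewrite !mxE liftK.
Qed.

Section succ.
Variables (n : nat) (mu : {sigma_finite_measure set 'rV[R]_n -> \bar R}).

Let prod : {measure set (measurableTypeR R * 'rV[R]_n)%type -> \bar R} :=
  (@lebesgue_measure R \x mu)%E.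

Definition lebesgue_rV_succ : set 'rV[R]_n.+1 -> \bar R :=
  pushforward (@lebesgue_measure R \x mu)%E (@cons_rV n).

Let nu : {measure set 'rV[R]_n.+1 -> \bar R} :=
  measure_function_pushforward__canonical__measure_function_Measure
    prod (@measurable_cons_rV n).

HB.instance Definition _ := isMeasure.Build _ _ _ lebesgue_rV_succ
  (@measure0 _ _ _ nu) (@measure_ge0 _ _ _ nu)
  (@measure_semi_sigma_additive _ _ _ nu).

Let lebesgue_rV_succ_sigma_finite : sigma_finite setT lebesgue_rV_succ.
Proof.
have /sigma_finiteP[F [TF ndF Foo]] := sigma_finiteT (@lebesgue_measure R).
have /sigma_finiteP[G [TG ndG Goo]] := sigma_finiteT mu.
exists (fun i => @uncons_rV n @^-1` (F i `*` G i)) => [|i].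
  apply/seteqP; split => // v _.
  have [i _ Fi] : (\bigcup_i F i) (uncons_rV v).1 by rewrite -TF.
  have [j _ Gj] : (\bigcup_i G i) (uncons_rV v).2 by rewrite -TG.
  exists (maxn i j) => //; split.
  - by move: Fi; exact/subsetPset/ndF/leq_maxl.
  - by move: Gj; exact/subsetPset/ndG/leq_maxr.
have [mF Fi] := Foo i; have [mG Gi] := Goo i; split.
  rewrite -[X in measurable X]setTI.
  exact: measurable_uncons_rV (measurableX mF mG).
rewrite /lebesgue_rV_succ /pushforward -comp_preimage.
rewrite (_ : _ \o _ = id); last by apply/funext => p /=; rewrite cons_rVK.
by rewrite preimage_id product_measure1E// lte_mul_pinfty// ge0_fin_numE.
Qed.

HB.instance Definition _ := Measure_isSigmaFinite.Build _ _ _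
  lebesgue_rV_succ lebesgue_rV_succ_sigma_finite.

End succ.

(* Lebesgue measure on R^n, as an iterated product of the one on R. *)
Fixpoint lebesgue_rV n : {sigma_finite_measure set 'rV[R]_n -> \bar R} :=
  if n is n'.+1 then lebesgue_rV_succ (lebesgue_rV n') else \d_(0 : 'rV[R]_0).

Lemma lebesgue_rV_box n (A : 'I_n -> set R) :
  (forall i, measurable (A i)) ->
  lebesgue_rV n [set v | forall i, A i (v ord0 i)] =
    (\prod_(i < n) lebesgue_measure (A i))%E.
Proof.
elim: n A => [|n IH] A mA /=.
  by rewrite big_ord0 /dirac indicE mem_set//= => -[].
rewrite big_ord_recl -IH// -product_measure1E//; last first.
- rewrite [X in measurable X](_ : _ =
      \bigcap_(i in setT) ((fun v : 'rV[R]_n => v ord0 i) @^-1`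
        A (lift ord0 i))).
    apply: fin_bigcap_measurable => // i _.
    by rewrite -[X in measurable X]setTI; apply: measurable_coord.
  by apply/seteqP; split=> [v h i _|v h i]; exact: h.
- exact: mA.
rewrite /lebesgue_rV_succ /pushforward; congr (_ _).
apply/seteqP; split => [p /= h|p /= [h0 h] i].
  split=> [|i] /=; first by have := h ord0; rewrite mxE unlift_none.
  by have := h (lift ord0 i); rewrite mxE liftK.
by rewrite mxE; case: unliftP => [j ->|->].
Qed.

End lebesgue_rV.

Section vectors.
Context {R : realType} {m : nat}.
Implicit Types u v : 'rV[R]_m.

Definition dotv u v : R := \sum_(i < m) u ord0 i * v ord0 i.

Definition enorm u : R := Num.sqrt (\sum_(i < m) u ord0 i ^+ 2).

Definition lev u v : bool := [forall i, u ord0 i <= v ord0 i].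

Definition orthant : set 'rV[R]_m := [set v | lev 0 v].

Definition vbox (lo hi : R) : set 'rV[R]_m :=
  [set v | forall i, lo <= v ord0 i <= hi].

End vectors.

Definition argmin {T : Type} {R : realType} (D : set T) (f : T -> R) : set T :=
  [set x | D x /\ forall y, D y -> f x <= f y].

Definition support {T : topologicalType} {R : realType} (mu : set T -> \bar R) :
    set T :=
  [set x | forall U, open U -> U x -> (0 < mu U)%E].

(* A request (a, r): resource consumption and reward. *)
Definition request (R : realType) (m : nat) := ('rV[R]_m * R)%type.

HB.instance Definition _ d1 d2 (T1 : measurableType d1)
    (T2 : measurableType d2) :=
  isMeasurableFun.Build _ _ _ _ (@fst T1 T2) (@measurable_fst _ _ T1 T2).

Section conditions.
Context {R : realType} {m : nat}.
Variable F : probability ('rV[R]_m * R)%type R.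

Definition marginal : probability 'rV[R]_m R := distribution F fst.

(* K is a regular conditional distribution of r given a. *)
Definition cond_distribution (K : R.-pker 'rV[R]_m ~> R) : Prop :=
  forall A B, measurable A -> measurable B ->
    F (A `*` B) = (\int[marginal]_(a in A) K a B)%E.

Definition cond_cdf (K : R.-pker 'rV[R]_m ~> R) (a : 'rV[R]_m) (z : R) : R :=
  fine (K a `]-oo, z]%classic).

Definition bounded_support (Al Au rb : R) : Prop :=
  [/\ 0 < Al, Al <= Au, 0 < rb &
    support F `<=` vbox Al Au `*` `[0, rb] ].

Definition cdf_growth (K : R.-pker 'rV[R]_m ~> R) (l u : 'rV[R]_m -> R) : Prop :=
  exists beta nu cnu cbeta : R,
    [/\ 0 <= beta, 0 < nu, 0 < cnu, 0 < cbeta &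
      forall a, support marginal a -> forall z1 z2 : R,
        l a <= z1 -> z1 < z2 -> z2 <= u a ->
        cbeta * (z2 - z1) `^ (1 + beta) <= cond_cdf K a z2 - cond_cdf K a z1 /\
        cond_cdf K a z2 - cond_cdf K a z1 <= cnu * (z2 - z1) `^ nu].

Definition condition_I (Al Au rb : R) : Prop :=
  bounded_support Al Au rb /\
  exists (K : R.-pker 'rV[R]_m ~> R) (ra : 'rV[R]_m -> R),
    [/\ cond_distribution K,
      forall a, support marginal a -> 0 < ra a /\ support (K a) = `[0, ra a]%classic &
      cdf_growth K (fun=> 0) ra].

Definition condition_II (Al Au rb : R) : Prop :=
  bounded_support Al Au rb /\
  exists (K : R.-pker 'rV[R]_m ~> R) (l u : 'rV[R]_m -> R),
    [/\ cond_distribution K,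
      [/\ convex_set (support marginal : set (convex_lmodType 'rV[R]_m)),
        compact (support marginal),
        exists (f : 'rV[R]_m -> R) (lf : R),
          [/\ measurable_fun setT f, forall a, 0 <= f a,
            forall A, measurable A ->
              marginal A = (\int[lebesgue_rV m]_(a in A) (f a)%:E)%E,
            0 < lf & forall a, support marginal a -> lf <= f a],
        forall a, support marginal a -> support (K a) = `[l a, u a]%classic &
        exists cL : R, forall a a', support marginal a -> support marginal a' ->
          `|l a - l a'| <= cL * enorm (a - a') /\
          `|u a - u a'| <= cL * enorm (a - a')],
      exists (ao : 'rV[R]_m) (r0 : R),
        [/\ support marginal ao, 0 < r0 &
          forall a, enorm (a - ao) < r0 -> support marginal a -> l a = 0] &
      cdf_growth K l u].

End conditions.

(* The first T terms of X are i.i.d. with distribution F. *)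
Definition iid_requests {R : realType} {m : nat} {d} {Omega : measurableType d}
    (P : probability Omega R) (F : probability ('rV[R]_m * R)%type R) (T : nat)
    (X : nat -> {RV P >-> ('rV[R]_m * R)%type}) : Prop :=
  (forall t, (t < T)%N -> forall B, measurable B -> distribution P (X t) B = F B)
  /\ forall B : nat -> set ('rV[R]_m * R)%type, (forall t, measurable (B t)) ->
    P (\bigcap_(t in `I_T) X t @^-1` B t) =
    (\prod_(t < T) P (X t @^-1` B t))%E.

(* Periods are numbered from 0: index t stands for period t + 1, so that the
   inventory available at index t is the one left after t decisions and T - t.+1
   periods remain afterwards. *)
Section model.
Context {R : realType} {m : nat}.
Implicit Types (x : nat -> request R m) (b lam : 'rV[R]_m).

Definition history x (t : nat) : t.-tuple (request R m) := [tuple x i | i < t].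

Definition hind_value x b (T : nat) : R :=
  sup [set \sum_(t < T) (x t).2 * y t | y in
    [set y : 'I_T -> R | (forall t, 0 <= y t <= 1) /\
      lev (\sum_(t < T) y t *: (x t).1) b]].

Definition ce_accept (q : request R m) b lam : bool :=
  (dotv q.1 lam <= q.2) && lev q.1 b.

Fixpoint ce_inventory b x (lam : nat -> 'rV[R]_m) (t : nat) : 'rV[R]_m :=
  if t is s.+1 then
    let c := ce_inventory b x lam s in
    if ce_accept (x s) c (lam s) then c - (x s).1 else c
  else b.

Definition ce_dual_obj (F : probability ('rV[R]_m * R)%type R) (T t : nat) b lam :
    R :=
  if t.+1 == T then dotv b lam
  else dotv b lam / (T - t.+1)%:R +
    \int[F]_q Num.max (q.2 - dotv q.1 lam) 0.

Definition hind_dual_obj x (T t : nat) b lam : R :=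
  dotv b lam + \sum_(t.+1 <= j < T) Num.max ((x j).2 - dotv (x j).1 lam) 0.

End model.

Definition regret {R : realType} {m : nat} {d} {Omega : measurableType d}
    (P : probability Omega R) (X : nat -> Omega -> request R m) (b : 'rV[R]_m)
    (T : nat) (accept : nat -> Omega -> bool) : \bar R :=
  ('E_P[fun w => hind_value (fun t => X t w) b T] -
   'E_P[fun w => (\sum_(t < T) (X t w).2 * (accept t w)%:R)%R])%E.

(* Main.v *)
Require Import Defs.
From HB Require Import structures.
From mathcomp Require Import all_boot all_order all_algebra.
From mathcomp Require Import all_classical all_reals all_analysis.
From mathcomp Require Import measurable_realfun zify ring lra.

Import Order.TTheory GRing.Theory Num.Theory.
Import numFieldNormedType.Exports.

Local Open Scope classical_set_scope.
Local Open Scope ring_scope.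

(** The inequality holds path by path, with a constant in place of the
    logarithm, and the expectation is taken at the very end.

    For a price vector lam >= 0 let D_t(c, lam) be the Lagrangian dual value of
    the requests t, ..., T-1 with inventory c, that is
    c . lam + sum_(j >= t) (r_j - a_j . lam)^+ ([tail_dual]). Weak duality bounds
    the hindsight optimum by D_0(b, lam) for every lam >= 0
    ([hind_value_le_tail_dual]). Going backwards in time, one builds along the
    path of inventories c_t a price lam with D_t(c_t, lam) at most the reward
    collected from period t on, plus the losses of the two expectations in the
    theorem, plus rb * Au / Al ([tail_dual_le_reward]).

    If every coordinate of c_t exceeds Au, then the request is feasible and the
    policy compares r_t with its own price only. When it accepts, a dual optimum
    lb for inventory c_t - a_t has
    D_t(c_t, lb) = D_(t+1)(c_t - a_t, lb) + max(r_t, a_t . lb), and the excess of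
    max(r_t, a_t . lb) over the reward r_t is the first loss. When it rejects, a
    dual optimum ls for inventory c_t has
    D_t(c_t, ls) = D_(t+1)(c_t, ls) + (r_t - a_t . ls)^+, and the positive part is
    the second loss.

    If instead some coordinate i of c_t is at most Au, the induction restarts:
    pricing resource i at rb / Al and the others at 0 leaves no request
    profitable, so the whole future is worth at most rb * Au / Al in hindsight,
    and this is paid once. In particular a rejection forced by lack of inventory
    never has to be analysed by itself. For m > 0 and T > 3 that constant is at
    most C0 * ln T ([depletion_cost_le]); for m = 0 there is no such i.

    Two points of measure theory remain. The almost sure bounds on a request come
    from the support of F, which has full measure because the topology of the
    request space has a countable base ([ae_support]). The hindsight value is a
    supremum over an uncountable set, so its integral is bounded by a monotonicity
    property that does not ask for its measurability
    ([ae_le_nonmeasurable_integral]). *)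

(** * Dual bounds along one sample path *)

Section pathwise.
Context {R : realType} {m : nat}.
Implicit Types (x : nat -> request R m) (b c lam : 'rV[R]_m) (q : request R m).

Lemma dotvBl b c lam : dotv (b - c) lam = dotv b lam - dotv c lam.
Proof.
by rewrite /dotv -sumrB; apply: eq_bigr => i _; rewrite !mxE mulrBl.
Qed.

Lemma dotv0r b : dotv b 0 = 0.
Proof. by rewrite /dotv big1// => i _; rewrite mxE mulr0. Qed.

Lemma dotv_delta b (s : R) i :
  dotv b (s *: delta_mx ord0 i) = s * b ord0 i.
Proof.
rewrite /dotv (bigD1 i)//= big1 ?addr0 => [|j ji]; rewrite !mxE !eqxx/=.
  by rewrite mulr1 mulrC.
by rewrite (negbTE ji) !mulr0.
Qed.

Lemma orthantE lam : orthant lam <-> forall i, 0 <= lam ord0 i.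
Proof.
split=> [/forallP h i|h]; first by have := h i; rewrite mxE.
by apply/forallP => i; rewrite mxE.
Qed.

(** The dual objective of the hindsight problem for the periods t, ..., T-1; the
    function [hind_dual_obj x T t] is [tail_dual x T t.+1]. *)
Definition tail_dual x (T t : nat) b lam : R :=
  dotv b lam + \sum_(t <= j < T) Num.max ((x j).2 - dotv (x j).1 lam) 0.

Lemma tail_dual_recl x T t b lam : (t < T)%N ->
  tail_dual x T t b lam = hind_dual_obj x T t b lam +
    Num.max ((x t).2 - dotv (x t).1 lam) 0.
Proof.
move=> tT; rewrite /tail_dual /hind_dual_obj big_ltn//.
by rewrite [X in _ + X]addrC addrA.
Qed.

Lemma hind_reward0 x b (T : nat) : lev 0 b ->
  [set \sum_(t < T) (x t).2 * y t | y in
    [set y : 'I_T -> R | (forall t, 0 <= y t <= 1) /\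
      lev (\sum_(t < T) y t *: (x t).1) b]] 0.
Proof.
move=> b0; exists (fun=> 0); last by rewrite big1// => t _; rewrite mulr0.
split=> [t|]; first by rewrite lexx ler01.
by rewrite big1// => t _; rewrite scale0r.
Qed.

Lemma hind_value_ge0 x b (T : nat) : lev 0 b -> 0 <= hind_value x b T.
Proof.
move=> b0; have := hind_reward0 x b T b0; rewrite /hind_value.
set E := (X in sup X) => E0; have [supE|nsupE] := pselect (has_sup E).
  exact: sup_upper_bound supE _ E0.
(* sup is 0 on sets without a supremum *)
by rewrite sup_out.
Qed.

(** Weak duality: the multipliers lam are paid for by the capacity constraint, and
    a fraction y_t in [0, 1] of r_t - a_t . lam is at most its positive part. *)
Lemma hind_value_le_tail_dual x b lam (T : nat) : lev 0 b -> orthant lam ->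
  hind_value x b T <= tail_dual x T 0 b lam.
Proof.
move=> b0 /orthantE lam0; apply: sup_le_ub.
  by exists 0; exact: hind_reward0.
move=> _ [y [y01 /forallP yb] <-].
have dotvb : \sum_(t < T) y t * dotv (x t).1 lam <= dotv b lam.
  under eq_bigr do rewrite mulr_sumr.
  rewrite exchange_big/=; apply: ler_sum => i _.
  under eq_bigr do rewrite mulrA.
  rewrite -mulr_suml ler_wpM2r//; apply: le_trans (yb i).
  by rewrite summxE; under [leRHS]eq_bigr do rewrite mxE.
rewrite /tail_dual big_mkord -lerBlDr; apply: le_trans dotvb.
rewrite -sumrB; apply: ler_sum => t _; rewrite lerBlDr.
have /andP[y0 y1] := y01 t; set a := dotv _ _.
have : (x t).2 - a <= Num.max ((x t).2 - a) 0 by rewrite le_max lexx.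
have : 0 <= Num.max ((x t).2 - a) 0 by rewrite le_max lexx orbT.
set M := Num.max _ _; nra.
Qed.

(** For a request accepted at prices lt, the excess over its reward of the price
    lb of what it consumes. *)
Definition accept_loss q c lt lb : R :=
  if lev q.1 c then
    (dotv q.1 lb - q.2) * (dotv q.1 lt <= q.2 <= dotv q.1 lb)%R%:R
  else 0.

(** For a request rejected at prices lt, the surplus it would have had at prices
    ls. *)
Definition reject_loss q lt ls : R :=
  (q.2 - dotv q.1 ls) * (dotv q.1 ls <= q.2 <= dotv q.1 lt)%R%:R.

Lemma accept_loss_ge0 q c lt lb : 0 <= accept_loss q c lt lb.
Proof.
rewrite /accept_loss; case: ifP => // _.
by case: (boolP (_ <= _ <= _)) => [/andP[_ h]|_]; rewrite ?mulr0// mulr1 subr_ge0.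
Qed.

Lemma reject_loss_ge0 q lt ls : 0 <= reject_loss q lt ls.
Proof.
rewrite /reject_loss.
by case: (boolP (_ <= _ <= _)) => [/andP[h _]|_]; rewrite ?mulr0// mulr1 subr_ge0.
Qed.

(** The consumption a_t leaves the capacity term and reappears as a_t . lb, which
    merges with (r_t - a_t . lb)^+ into max(r_t, a_t . lb). *)
Lemma tail_dual_accept x T t c lt lb lam : (t < T)%N ->
  ce_accept (x t) c lt -> orthant lam ->
  argmin orthant (hind_dual_obj x T t (c - (x t).1)) lb ->
  tail_dual x T t c lb <=
    (x t).2 + accept_loss (x t) c lt lb + tail_dual x T t.+1 (c - (x t).1) lam.
Proof.
move=> tT /andP[ar ac] lam0 [_ /(_ _ lam0) le_lam].
rewrite tail_dual_recl// /accept_loss ac ar/=.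
move: le_lam; rewrite /hind_dual_obj /tail_dual !dotvBl => le_lam.
have [le_r|lt_r] := leP (x t).2 (dotv (x t).1 lb).
  by rewrite max_r ?subr_le0// mulr1; lra.
by rewrite max_l ?subr_ge0 ?(ltW lt_r)// mulr0; lra.
Qed.

Lemma tail_dual_reject x T t c lt ls lam : (t < T)%N ->
  (x t).2 < dotv (x t).1 lt -> orthant lam ->
  argmin orthant (hind_dual_obj x T t c) ls ->
  tail_dual x T t c ls <= reject_loss (x t) lt ls + tail_dual x T t.+1 c lam.
Proof.
move=> tT /ltW ra lam0 [_ /(_ _ lam0) le_lam].
rewrite tail_dual_recl// /reject_loss ra andbT.
rewrite -[tail_dual x T t.+1 c lam]/(hind_dual_obj x T t c lam).
have [le_r|lt_r] := leP (dotv (x t).1 ls) (x t).2.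
  by rewrite max_l ?subr_ge0// mulr1; lra.
by rewrite max_r ?subr_le0 ?(ltW lt_r)// mulr0; lra.
Qed.

(** At price rb / Al for resource i a request costs at least rb, so only the
    capacity term of the dual survives. *)
Lemma tail_dual_depleted x T t c i (Al Au rb : R) :
  0 < Al -> 0 <= rb -> c ord0 i <= Au ->
  (forall s, (s < T)%N -> Al <= (x s).1 ord0 i /\ (x s).2 <= rb) ->
  tail_dual x T t c ((rb / Al) *: delta_mx ord0 i) <= rb * Au / Al.
Proof.
move=> Al0 rb0 ciAu xbox.
rewrite /tail_dual dotv_delta big_nat big1 ?addr0 => [|s /andP[_ /xbox[Als rs]]].
  by rewrite [leRHS]mulrAC ler_wpM2l// divr_ge0// ltW.
apply/max_idPr; rewrite dotv_delta subr_le0; apply: le_trans rs _.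
by rewrite -mulrA ler_peMr// mulrC ler_pdivlMr// mul1r.
Qed.

(** Backward induction on the period. The optimality of [lams t] and [lamb t] is
    used against the price that the induction provides for the next period. The
    bound on C is conditional on an index because without resources nothing can be
    depleted. *)
Lemma tail_dual_le_reward x T b (lamt lams lamb : nat -> 'rV[R]_m) (Al Au rb C : R) :
  let inv t := ce_inventory b x lamt t in
  0 < Al -> 0 <= C -> (forall i : 'I_m, rb * Au / Al <= C) ->
  (forall t, (t < T)%N ->
    (forall i, Al <= (x t).1 ord0 i <= Au) /\ 0 <= (x t).2 <= rb) ->
  (forall t, (t < T)%N -> argmin orthant (hind_dual_obj x T t (inv t)) (lams t)) ->
  (forall t, (t < T)%N -> lev (x t).1 (inv t) ->
    argmin orthant (hind_dual_obj x T t (inv t - (x t).1)) (lamb t)) ->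
  forall t, (t <= T)%N -> exists2 lam, orthant lam &
  tail_dual x T t (inv t) lam <= C + \sum_(t <= s < T)
    ((x s).2 * (ce_accept (x s) (inv s) (lamt s))%:R +
     accept_loss (x s) (inv s) (lamt s) (lamb s) +
     reject_loss (x s) (lamt s) (lams s)).
Proof.
move=> inv Al0 C0 CAu xbox lamsP lambP t tT.
rewrite -(subKn tT); move: (leq_subr t T).
elim: (T - t)%N => {t tT} [_|n IH nT].
  rewrite subn0; exists 0; first by apply/orthantE => i; rewrite mxE.
  by rewrite /tail_dual dotv0r !big_geq// !addr0.
have := IH (ltnW nT); rewrite -(subnSK nT); set t := (T - n.+1)%N.
have tT : (t < T)%N by rewrite /t; lia.
move=> [lam lam0 IHlam]; have [abox /andP[r0 rrb]] := xbox _ tT.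
have gain_ge0 s : (s < T)%N -> 0 <=
    (x s).2 * (ce_accept (x s) (inv s) (lamt s))%:R +
     accept_loss (x s) (inv s) (lamt s) (lamb s) +
     reject_loss (x s) (lamt s) (lams s).
  move=> /xbox[_ /andP[rs0 _]].
  by rewrite !addr_ge0 ?accept_loss_ge0 ?reject_loss_ge0// mulr_ge0.
have [/existsP[i ciAu]|] := boolP [exists i, inv t ord0 i <= Au].
  exists ((rb / Al) *: delta_mx ord0 i).
    apply/orthantE => j; rewrite !mxE mulr_ge0// divr_ge0 ?(ltW Al0)//.
    exact: le_trans rrb.
  apply: (@le_trans _ _ (rb * Au / Al)).
    apply: tail_dual_depleted => // [|s sT]; first exact: le_trans rrb.
    have [abox_s /andP[_ rs]] := xbox _ sT.
    by have /andP[Als _] := abox_s i.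
  apply: (le_trans (CAu i)); rewrite lerDl big_nat sumr_ge0// => s /andP[_].
  exact: gain_ge0.
rewrite negb_exists => /forallP c_large.
have at_le : lev (x t).1 (inv t).
  apply/forallP => i; have := c_large i; rewrite -ltNge => /ltW.
  by apply: le_trans; case/andP: (abox i).
have invS : inv t.+1 = if ce_accept (x t) (inv t) (lamt t)
                       then inv t - (x t).1 else inv t by [].
move: (gain_ge0 _ tT) IHlam; rewrite [in X in _ -> _ -> X]big_ltn// invS.
case: ifPn => [acc _ IHlam|].
  exists (lamb t); first by case: (lambP _ tT at_le).
  apply: le_trans (tail_dual_accept _ _ _ _ _ _ _ tT acc lam0 (lambP _ tT at_le)) _.
  have := reject_loss_ge0 (x t) (lamt t) (lams t).
  by move: IHlam; rewrite mulr1; clear CAu; lra.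
rewrite {1}/ce_accept at_le andbT -ltNge => rej _ IHlam.
exists (lams t); first by case: (lamsP _ tT).
apply: le_trans (tail_dual_reject _ _ _ _ _ _ _ tT rej lam0 (lamsP _ tT)) _.
have := accept_loss_ge0 (x t) (inv t) (lamt t) (lamb t).
by move: IHlam; rewrite mulr0; clear CAu; lra.
Qed.

End pathwise.
(** * Almost sure bounds on the requests *)

Section support.
Context {R : realType} {m : nat}.
Implicit Types (q : request R m) (U : set ('rV[R]_m * R)%type).

(** The open cubes with rational centre and radius form a countable base of the
    request space. *)
Definition rat_cube (k : 'rV[rat]_m * rat * rat) : set ('rV[R]_m * R)%type :=
  [set q : 'rV[R]_m * R | (forall i, `|ratr (k.1.1 ord0 i) - q.1 ord0 i| < ratr k.2) /\
           `|ratr k.1.2 - q.2| < ratr k.2].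

Lemma measurable_rat_cube k : measurable (rat_cube k).
Proof.
have -> : rat_cube k =
    (\bigcap_(i in [set: 'I_m])
      ((fun q : 'rV[R]_m * R => q.1 ord0 i) @^-1`
         ball (ratr (k.1.1 ord0 i) : R) (ratr k.2))) `&`
    (snd @^-1` ball (ratr k.1.2 : R) (ratr k.2)).
  by apply/seteqP; split=> q [h1 h2]; split=> // i; [move=> _|]; exact: h1.
apply: measurableI.
  apply: fin_bigcap_measurable => // i _; rewrite -[X in measurable X]setTI.
  have mf : measurable_fun setT (fun q : 'rV[R]_m * R => q.1 ord0 i).
    exact: (measurableT_comp (measurable_coord (T := R) i) measurable_fst).
  by apply: mf => //; exact: measurable_ball.
rewrite -[X in measurable X]setTI; apply: measurable_snd => //.
exact: measurable_ball.
Qed.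

Lemma rat_approx (z e : R) : 0 < e -> exists s : rat, `|ratr s - z| < e.
Proof.
move=> e0; have [|s] := @rat_in_itvoo R (z - e) (z + e); first by lra.
by rewrite in_itv/= => /andP[? ?]; exists s; rewrite ltr_distlC; lra.
Qed.

Lemma open_rat_cube U q : open U -> U q ->
  exists2 k, rat_cube k q & rat_cube k `<=` U.
Proof.
rewrite openE => /(_ q)/[apply] /nbhs_ballP[e /= e0 ballU].
have [|dl] := @rat_in_itvoo R 0 (e / 2); first by lra.
rewrite in_itv/= => /andP[dl0 dle].
have /fin_all_exists[ca caP] : forall i : 'I_m, exists s : rat,
    `|ratr s - q.1 ord0 i| < ratr dl by move=> i; exact: rat_approx.
have [cr crP] := rat_approx q.2 _ dl0.
exists (\row_i ca i, cr, dl); first by split=> //= i; rewrite mxE.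
move=> q' [/= h1 h2]; apply: ballU.
have tri (u v w : R) : `|u - v| < ratr dl -> `|u - w| < ratr dl -> `|v - w| < e.
  rewrite ![`|u - _|]distrC => uv uw; rewrite -(subrKA u).
  by apply: (le_lt_trans (ler_normD _ _)); rewrite [`|u - w|]distrC; lra.
split=> /=; last exact: tri crP h2.
split=> // i j; rewrite ord1; apply: tri (caP j) _.
by have := h1 j; rewrite mxE.
Qed.

(** An open set is the countable union of the rational cubes that it contains; so
    the Borel sets of the topology belong to the product sigma-algebra. *)
Lemma open_measurable_request U : open U -> measurable U.
Proof.
move=> oU.
have -> : U = \bigcup_n (if @unpickle ('rV[rat]_m * rat * rat)%type n is Some k
    then if `[< rat_cube k `<=` U >] then rat_cube k else set0 else set0).
  apply/seteqP; split=> [q Uq|q [n _]].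
    have [k kq kU] := open_rat_cube _ _ oU Uq.
    by exists (pickle k); [exact: I|rewrite pickleK asboolT].
  by case: unpickle => // k; case: asboolP => // kU /kU.
apply: bigcup_measurable => n _.
by case: unpickle => // k; case: ifP => // _; exact: measurable_rat_cube.
Qed.

(** Outside of the support every point lies in a null open set, hence in a null
    rational cube, and these cubes are countably many. *)
Lemma ae_support (F : probability ('rV[R]_m * R)%type R) :
  {ae F, forall q, Defs.support F q}.
Proof.
pose N := \bigcup_n (if @unpickle ('rV[rat]_m * rat * rat)%type n is Some k
  then if F (rat_cube k) == 0%E then rat_cube k else set0 else set0).
have : F.-negligible N.
  apply: negligible_bigcup => n.
  case: unpickle => [k|]; last exact: negligible_set0.
  case: ifP => [/eqP Fk0|_]; last exact: negligible_set0.
  by exists (rat_cube k); split=> //; exact: measurable_rat_cube.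
apply: negligibleS => q; rewrite /Defs.support/= => /existsNP[U].
move=> /not_implyP[oU /not_implyP[Uq /negP]]; rewrite -leNgt => FU0.
have [k kq kU] := open_rat_cube _ _ oU Uq.
exists (pickle k); first exact: I.
rewrite pickleK ifT//.
rewrite -measure_le0; apply: le_trans FU0.
apply: le_measure => //; rewrite inE; first exact: measurable_rat_cube.
exact: open_measurable_request.
Qed.

End support.

Lemma ae_distribution {R : realType} {d d'} {Omega : measurableType d}
    {E : measurableType d'} (P : probability Omega R) (Y : {RV P >-> E})
    (F : probability E R) (A : E -> Prop) :
  (forall B, measurable B -> distribution P Y B = F B) ->
  {ae F, forall q, A q} -> {ae P, forall w, A (Y w)}.
Proof.
move=> YF [N [mN FN0 AN]]; exists (Y @^-1` N); split.
- by rewrite -[X in measurable X]setTI; exact: measurable_funPT.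
- by have := YF _ mN; rewrite /distribution/= /pushforward => ->.
- by move=> w nAw; exact: AN.
Qed.

(** The integral of a nonnegative function is a supremum over the simple functions
    below it, which makes it monotone for all functions f. On the exceptional null
    set, g is raised to +oo, which keeps its integral because g is measurable. *)
Lemma ae_le_nonmeasurable_integral {R : realType} {d} {Omega : measurableType d}
    (mu : {measure set Omega -> \bar R}) (f g : Omega -> \bar R) :
  (forall w, 0 <= f w)%E -> (forall w, 0 <= g w)%E -> measurable_fun setT g ->
  {ae mu, forall w, (f w <= g w)%E} ->
  (\int[mu]_w f w <= \int[mu]_w g w)%E.
Proof.
move=> f0 g0 mg [N [mN muN0 fgN]].
pose g' w := if w \in N then +oo%E else g w.
have mg' : measurable_fun setT g'.
  apply: measurable_fun_ifT => //.
  apply: (measurable_fun_bool true); rewrite setTI.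
  rewrite [X in measurable X](_ : _ = N)//.
  by apply/seteqP; split=> w /=; [move=> /set_mem|move=> /mem_set].
have -> : (\int[mu]_w g w = \int[mu]_w g' w)%E.
  apply: ae_eq_integral => //; exists N; split=> // w /=.
  apply: contra_notP => nNw _; rewrite /g' memNset//.
have g'0 w : (0 <= g' w)%E by rewrite /g'; case: ifP.
have fg' w : (f w <= g' w)%E.
  rewrite /g'; case: ifPn => [_|]; first exact: leey.
  by rewrite notin_setE => nNw; apply: contra_notP nNw => fg; exact: fgN.
rewrite !ge0_integralTE//; apply: ge_ereal_sup => _ [h hf <-].
by apply: ereal_sup_ubound; exists h => // w; exact: le_trans (hf w) _.
Qed.

(** * Measurability of the policy *)

Section measurability.
Context {R : realType} {m : nat} {d} {Omega : measurableType d}.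
Implicit Types (D : set Omega) (f g : Omega -> 'rV[R]_m).

Lemma measurable_fun_coord D f i : measurable_fun D f ->
  measurable_fun D (fun w => f w ord0 i).
Proof. exact: (measurableT_comp (measurable_coord (T := R) i)). Qed.

Lemma measurable_fun_dotv D f g : measurable_fun D f -> measurable_fun D g ->
  measurable_fun D (fun w => dotv (f w) (g w)).
Proof.
move=> mf mg; apply: measurable_sum => i.
by apply: measurable_funM; exact: measurable_fun_coord.
Qed.

Lemma measurable_fun_lev f g : measurable_fun setT f -> measurable_fun setT g ->
  measurable_fun setT (fun w => lev (f w) (g w)).
Proof.
move=> mf mg; apply: (measurable_fun_bool true); rewrite setTI.
have -> : (fun w => lev (f w) (g w)) @^-1` [set true] = \bigcap_(i in [set: 'I_m])
    [set w | f w ord0 i <= g w ord0 i].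
  apply/seteqP; split=> w /=; first by move=> /forallP h i _; exact: h.
  by move=> h; apply/forallP => i; exact: h.
apply: fin_bigcap_measurable => // i _.
have := measurable_fun_ler (measurable_fun_coord _ _ i mf)
  (measurable_fun_coord _ _ i mg).
by move=> /(_ measurableT [set true] I); rewrite setTI.
Qed.

Lemma measurable_fun_natr_bool D (h : Omega -> bool) : measurable_fun D h ->
  measurable_fun D (fun w => (h w)%:R : R).
Proof.
by move=> mh; exact: (@measurableT_comp _ _ _ _ _ _ (fun b : bool => b%:R : R)).
Qed.

Lemma measurable_fun_ce_accept (q : Omega -> request R m) f g :
  measurable_fun setT q -> measurable_fun setT f -> measurable_fun setT g ->
  measurable_fun setT (fun w => ce_accept (q w) (f w) (g w)).
Proof.
move=> mq mf mg; have m1 := measurableT_comp measurable_fst mq.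
have m2 := measurableT_comp measurable_snd mq.
apply: measurable_and; last exact: measurable_fun_lev.
by apply: measurable_fun_ler => //; exact: measurable_fun_dotv.
Qed.

Lemma measurable_fun_ce_inventory (b : 'rV[R]_m) (X : nat -> Omega -> request R m)
    (lam : nat -> Omega -> 'rV[R]_m) (t : nat) :
  (forall s, measurable_fun setT (X s)) ->
  (forall s, (s < t)%N -> measurable_fun setT (lam s)) ->
  measurable_fun setT (fun w => ce_inventory b (X^~ w) (lam^~ w) t).
Proof.
move=> mX; elim: t => [_|t IH mlam] /=; first exact: measurable_cst.
have minv := IH (fun s st => mlam s (ltnW st)).
apply: measurable_fun_ifT => //.
  exact: measurable_fun_ce_accept (mlam t _).
apply/measurable_fun_rVP => i.
under eq_fun do rewrite !mxE.
apply: measurable_funB; first exact: measurable_fun_coord.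
exact: measurable_fun_coord (measurableT_comp measurable_fst (mX t)).
Qed.

Lemma measurable_fun_history (X : nat -> Omega -> request R m) (t : nat) :
  (forall s, measurable_fun setT (X s)) ->
  measurable_fun setT (fun w => history (X^~ w) t).
Proof.
move=> mX; apply/measurable_fun_tnthP => i.
rewrite (_ : _ \o _ = X i)//.
by apply/funext => w /=; rewrite tnth_mktuple.
Qed.

Lemma measurable_fun_accept_loss (q : Omega -> request R m) f g h :
  measurable_fun setT q -> measurable_fun setT f -> measurable_fun setT g ->
  measurable_fun [set w | lev (q w).1 (f w)] h ->
  measurable_fun setT (fun w => accept_loss (q w) (f w) (g w) (h w)).
Proof.
move=> mq mf mg mh; have m1 := measurableT_comp measurable_fst mq.
have m2 := measurableT_comp measurable_snd mq.
apply: measurable_fun_if => //; first exact: measurable_fun_lev.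
rewrite setTI.
have mdh : measurable_fun [set w | lev (q w).1 (f w)]
    (fun w => dotv (q w).1 (h w)).
  by apply: measurable_fun_dotv => //; exact: measurable_funTS.
apply: measurable_funM; first by apply: measurable_funB => //; exact: measurable_funTS.
apply: measurable_fun_natr_bool; apply: measurable_and.
  apply: measurable_funTS; apply: measurable_fun_ler => //.
  exact: measurable_fun_dotv.
by apply: measurable_fun_ler => //; exact: measurable_funTS.
Qed.

Lemma measurable_fun_reject_loss (q : Omega -> request R m) g h :
  measurable_fun setT q -> measurable_fun setT g -> measurable_fun setT h ->
  measurable_fun setT (fun w => reject_loss (q w) (g w) (h w)).
Proof.
move=> mq mg mh; have m1 := measurableT_comp measurable_fst mq.
have m2 := measurableT_comp measurable_snd mq.
have mdg := measurable_fun_dotv _ _ _ m1 mg.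
have mdh := measurable_fun_dotv _ _ _ m1 mh.
apply: measurable_funM; first exact: measurable_funB.
apply: measurable_fun_natr_bool.
by apply: measurable_and; exact: measurable_fun_ler.
Qed.

End measurability.

(** * The regret bound *)

(** Here m >= 1 makes (1 + m * Au / Al) * m at least Au / Al, and T >= 4 makes
    2 * ln T at least 1. *)
Lemma depletion_cost_le {R : realType} (m T : nat) (Al Au rb : R) :
  (0 < m)%N -> (3 < T)%N -> 0 < Al -> 0 <= Au -> 0 <= rb ->
  rb * Au / Al <= 2 * (1 + m%:R * Au / Al) * m%:R * rb * ln T%:R.
Proof.
move=> m0 T3 Al0 Au0 rb0.
have lnT : 3 / 4 <= ln T%:R :> R.
  (* ln 4 = - ln (1 - 3 / 4) *)
  have := @le_ln1Dx R (- (3 / 4)); rewrite (_ : 1 + _ = 4^-1 :> R); last by field.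
  rewrite lnV ?posrE// lerN2 => /(_ _) h; apply: le_trans (h _) _; first lra.
  by rewrite ler_ln ?posrE ?ltr0n ?ler_nat//; exact: leq_trans T3.
rewrite -(mulrA rb) -(mulrA m%:R); set k := Au / Al.
have k0 : 0 <= k by rewrite divr_ge0// ltW.
have m1 : 1 <= m%:R :> R by rewrite ler1n.
have : k <= (1 + m%:R * k) * m%:R.
  have mk : k <= m%:R * k by exact: ler_peMl.
  by apply: (@le_trans _ _ (1 + m%:R * k)); [|apply: ler_peMr]; lra.
set z := (1 + _) * _ => kz.
have z0 : 0 <= z := le_trans k0 kz.
rewrite [leRHS](_ : _ = rb * (z * (2 * ln T%:R))); last by rewrite /z; ring.
by apply: ler_wpM2l => //; nra.
Qed.

Theorem lemma5p1 (R : realType) (m : nat)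
    (F : probability ('rV[R]_m * R)%type R) (Al Au rb : R)
    (HF : condition_I F Al Au rb \/ condition_II F Al Au rb)
    (T : nat) (HT : (3 < T)%N) (b : 'rV[R]_m) (Hb : lev 0 b)
    (d : measure_display) (Omega : measurableType d) (P : probability Omega R)
    (X : nat -> {RV P >-> ('rV[R]_m * R)%type}) (HX : iid_requests F T X)
    (sel : forall t : nat, t.-tuple ('rV[R]_m * R)%type -> 'rV[R]_m)
    (Hsel : forall t, (t < T)%N -> measurable_fun setT (sel t))
    (lams lamb : nat -> Omega -> 'rV[R]_m) :
  let C0 := 2 * (1 + m%:R * Au / Al) * m%:R * rb in
  let path w := fun t => X t w in
  let lamt t w := sel t (history (path w) t) in
  let inv t w := ce_inventory b (path w) (fun s => lamt s w) t in
  let a t w : 'rV[R]_m := (X t w).1 in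
  let r t w : R := (X t w).2 in
  (forall t, (t < T)%N -> {ae P, forall w,
    (argmin orthant (ce_dual_obj F T t (inv t w)) `&` vbox 0 (rb / Al))
      (lamt t w)}) ->
  (forall t, (t < T)%N -> measurable_fun setT (lams t)) ->
  (forall t, (t < T)%N -> {ae P, forall w,
    (argmin orthant (hind_dual_obj (path w) T t (inv t w))
       `&` vbox 0 (rb / Al)) (lams t w)}) ->
  (forall t, (t < T)%N ->
    measurable_fun [set w | lev (a t w) (inv t w)] (lamb t)) ->
  (forall t, (t < T)%N -> {ae P, forall w, lev (a t w) (inv t w) ->
    (argmin orthant (hind_dual_obj (path w) T t (inv t w - a t w))
       `&` vbox 0 (rb / Al)) (lamb t w)}) ->
  (regret P X b T (fun t w => ce_accept (X t w) (inv t w) (lamt t w)) <=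
   (C0 * ln T%:R)%:E
   + \sum_(t < T) 'E_P[fun w =>
       (if lev (a t w) (inv t w) then
          (dotv (a t w) (lamb t w) - r t w) *
          (dotv (a t w) (lamt t w) <= r t w <= dotv (a t w) (lamb t w))%R%:R
        else 0)%R]
   + \sum_(t < T) 'E_P[fun w =>
       ((r t w - dotv (a t w) (lams t w)) *
        (dotv (a t w) (lams t w) <= r t w <= dotv (a t w) (lamt t w))%R%:R)%R])%E.
Proof.
move=> C0 path lamt inv a r _ mlams lamsP mlamb lambP.
have [[Al0 AlAu rb0 suppF] _] : bounded_support F Al Au rb /\ True.
  by case: HF => -[].
have Au0 : 0 <= Au by exact: le_trans (ltW Al0) AlAu.
have C_ge0 : 0 <= C0 * ln T%:R.
  rewrite !mulr_ge0 ?ln_ge0 ?ler1n ?(ltn_trans _ HT)// ?(ltW rb0)//.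
  by rewrite addr_ge0// divr_ge0 ?mulr_ge0// ltW.
have costC (i : 'I_m) : rb * Au / Al <= C0 * ln T%:R.
  by apply: depletion_cost_le => //; [exact: leq_ltn_trans (ltn_ord i)|exact: ltW].
have mX t : measurable_fun setT (X t) by exact: measurable_funPT.
have mlamt t : (t < T)%N -> measurable_fun setT (lamt t).
  move=> tT; apply: measurableT_comp; first exact: Hsel.
  exact: (measurable_fun_history _ _ mX).
have minv t : (t < T)%N -> measurable_fun setT (inv t).
  move=> tT; apply: (measurable_fun_ce_inventory _ _ _ _ mX) => s st.
  by apply: mlamt; exact: ltn_trans tT.
have X_box t : (t < T)%N -> {ae P, forall w,
    (forall i, Al <= a t w ord0 i <= Au) /\ 0 <= r t w <= rb}.
  move=> tT; apply: (ae_distribution P (X t) F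
    (fun q => (forall i, Al <= q.1 ord0 i <= Au) /\ 0 <= q.2 <= rb)).
    by move=> B mB; exact: HX.1.
  by apply: filterS (ae_support F) => q /suppF[/= ? ]; rewrite in_itv.
have {lamsP lambP X_box}good : {ae P, forall w, forall t, (t < T)%N ->
    [/\ (forall i, Al <= a t w ord0 i <= Au) /\ 0 <= r t w <= rb,
      argmin orthant (hind_dual_obj (path w) T t (inv t w)) (lams t w) &
      lev (a t w) (inv t w) ->
      argmin orthant (hind_dual_obj (path w) T t (inv t w - a t w)) (lamb t w)]}.
  apply: ae_foralln => t; have [tT|] := ltnP t T; last first.
    by move=> _; exact: aeW.
  apply: filterS3 (X_box _ tT) (lamsP _ tT) (lambP _ tT) => w h1 [h2 _] h3 _.
  by split=> // /h3[].
pose reward w := \sum_(t < T) r t w * (ce_accept (X t w) (inv t w) (lamt t w))%:R.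
pose A (t : 'I_T) w := accept_loss (X t w) (inv t w) (lamt t w) (lamb t w).
pose B (t : 'I_T) w := reject_loss (X t w) (lamt t w) (lams t w).
have mreward : measurable_fun setT reward.
  apply: measurable_sum => t; apply: measurable_funM.
    exact: measurableT_comp measurable_snd (mX t).
  apply: measurable_fun_natr_bool.
  by apply: measurable_fun_ce_accept (minv _ _) (mlamt _ _).
have mA t : measurable_fun setT (A t).
  by apply: measurable_fun_accept_loss (minv _ _) (mlamt _ _) (mlamb _ _).
have mB t : measurable_fun setT (B t).
  by apply: measurable_fun_reject_loss (mlamt _ _) (mlams _ _).
have A0 t w : (0 <= (A t w)%:E)%E by rewrite lee_fin accept_loss_ge0.
have B0 t w : (0 <= (B t w)%:E)%E by rewrite lee_fin reject_loss_ge0.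
have reward_bnd : {ae P, forall w, 0 <= reward w <= T%:R * rb}.
  apply: filterS good => w good_w; apply/andP; split.
    by apply: sumr_ge0 => t _; have [[_ /andP[? _]]] := good_w t (ltn_ord t);
      rewrite mulr_ge0.
  rewrite mulr_natl -[X in _ *+ X]card_ord -sumr_const; apply: ler_sum => t _.
  have [[_ /andP[r0 rrb]] _ _] := good_w t (ltn_ord t).
  by case: ce_accept; rewrite ?mulr1// mulr0 ltW.
have hind_le : {ae P, forall w, hind_value (path w) b T <=
    reward w + C0 * ln T%:R + \sum_t A t w + \sum_t B t w}.
  apply: filterS good => w good_w.
  have [lam lam0] := @tail_dual_le_reward R m (path w) T b
    (lamt^~ w) (lams^~ w) (lamb^~ w) Al Au rb _ Al0 C_ge0 costC
    (fun t tT => let: And3 h _ _ := good_w t tT in h)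
    (fun t tT => let: And3 _ h _ := good_w t tT in h)
    (fun t tT => let: And3 _ _ h := good_w t tT in h) 0%N (leq0n T).
  rewrite big_mkord !big_split/= => le_lam.
  apply: le_trans (hind_value_le_tail_dual _ _ _ _ Hb lam0) _.
  by apply: le_trans le_lam _; rewrite -!addrA [leLHS]addrCA.
rewrite /regret unlock.
(* The reward is nonnegative only almost surely, its absolute value everywhere, as
   the additivity of integrals of nonnegative functions requires. *)
have -> : (\int[P]_w (reward w)%:E = \int[P]_w `|reward w|%:E)%E.
  apply: ae_eq_integral => //; first exact/measurable_EFinP.
    by apply/measurable_EFinP; exact: measurableT_comp.
  by apply: filterS reward_bnd => w /andP[r0 _] _; rewrite ger0_norm.
have absr_fin : (\int[P]_w `|reward w|%:E)%E \is a fin_num.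
  rewrite ge0_fin_numE ?integral_ge0//.
  apply: (@le_lt_trans _ _ (\int[P]_w (T%:R * rb)%:E)%E); last first.
    by rewrite integral_cst//= probability_setT mule1 ltry.
  apply: (ae_le_nonmeasurable_integral P (fun w => `|reward w|%:E) (fun=> (T%:R * rb)%:E)) => //.
    by move=> w; rewrite lee_fin mulr_ge0// ltW.
  by apply: filterS reward_bnd => w /andP[r0 ?]; rewrite lee_fin ger0_norm.
rewrite leeBlDr//.
have mE f : measurable_fun setT f -> measurable_fun setT (EFin \o f : Omega -> \bar R).
  by move=> ?; exact/measurable_EFinP.
have -> : ((C0 * ln T%:R)%:E + \sum_(t < T) \int[P]_w (A t w)%:E +
    \sum_(t < T) \int[P]_w (B t w)%:E + \int[P]_w `|reward w|%:E =
  \int[P]_w (`|reward w|%:E + (C0 * ln T%:R)%:E + \sum_(t < T) (A t w)%:E +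
    \sum_(t < T) (B t w)%:E))%E.
  have mr : measurable_fun setT (fun w => `|reward w|%:E).
    by apply: mE; exact: measurableT_comp.
  have mSA : measurable_fun setT (fun w => \sum_(t < T) (A t w)%:E)%E.
    by apply: emeasurable_sum => t; exact: mE.
  have mSB : measurable_fun setT (fun w => \sum_(t < T) (B t w)%:E)%E.
    by apply: emeasurable_sum => t; exact: mE.
  have SA0 w : (0 <= \sum_(t < T) (A t w)%:E)%E by exact: sume_ge0.
  have SB0 w : (0 <= \sum_(t < T) (B t w)%:E)%E by exact: sume_ge0.
  have r0 w : (0 <= `|reward w|%:E)%E by rewrite lee_fin.
  have c0 : (0 <= (C0 * ln T%:R)%:E)%E by rewrite lee_fin.
  rewrite !ge0_integralD//; try (by move=> *; rewrite ?adde_ge0);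
    try by repeat apply: emeasurable_funD.
  rewrite !ge0_integral_sum//; last 2 first.
    by move=> t; exact: mE.
    by move=> t; exact: mE.
  rewrite integral_cst//= probability_setT mule1.
  by rewrite addeC !addeA.
apply: ae_le_nonmeasurable_integral => //.
- by move=> w; rewrite lee_fin hind_value_ge0.
- by move=> w; rewrite !adde_ge0 ?sume_ge0// lee_fin.
- repeat apply: emeasurable_funD => //; try exact: mE.
  + by apply: mE; exact: measurableT_comp.
  + by apply: emeasurable_sum => t; exact: mE.
  + by apply: emeasurable_sum => t; exact: mE.
apply: filterS hind_le => w; rewrite !sumEFin -!EFinD lee_fin => /le_trans; apply.
by rewrite !lerD2r ler_norm.
Qed.
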